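(* Let $\mathcal C\subset\mathbb R^n$ be nonempty, compact and convex; let $f:\mathbb R^n\to\mathbb R$ be continuously differentiable on an open set containing $\mathcal C$ with $\nabla f$ Lipschitz-continuous on $\mathcal C$; let $T:\mathbb R^n\to\mathbb R^m$ be linear; let $\mathcal D\subset\mathbb R^m$ be nonempty, closed and convex with $\mathcal D\cap T(\mathcal C)=\varnothing$; and let $g=\iota_{\mathcal D}$. Let $\delta:=\min_{x\in\mathcal C}\mathrm{dist}_{\mathcal D}(Tx)$ and $\mathcal C^\dagger:=\operatorname{argmin}_{x\in\mathcal C}\mathrm{dist}_{\mathcal D}(Tx)$. Suppose $(u_j)_j\subset\mathcal C$ and $(\alpha_j)_j\subset\,]0,+\infty[$ satisfy $\alpha_j\to0$, $u_j\to\bar u$, and $\mathrm{gap}^{\alpha_j}(u_j)\to0$. Then $\mathrm{dist}_{\mathcal D}(Tu_j)\to\delta$ and $\mathrm{dist}_{\mathcal C^\dagger}(u_j)\to0$. Moreover, $$\max_{s\in\mathcal C^\dagger}\langle\nabla f(u_j),u_j-s\rangle\to0.$$ Consequently, every cluster point $\bar u$ of $(u_j)_j$ belongs to $\mathcal C^\dagger$ and satisfies $$0\in T^*(T\bar u-\mathrm{proj}_{\mathcal D}(T\bar u))+N_{\mathcal C}(\bar u).$$ Furthermore, $\bar u$ is stationary for the problem $\min_{x\in\mathcal C^\dagger}f(x)$, i.e., $0\in\nabla f(\bar u)+N_{\mathcal C^\dagger}(\bar u)$, equivalently $\max_{s\in\mathcal C^\dagger}\langle\nabla f(\bar u),\bar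 u-s\rangle=0$. In particular, if $f$ is convex on $\mathcal C^\dagger$, then $\bar u\in\operatorname{argmin}_{x\in\mathcal C^\dagger}f(x)$.
   Context: $\iota_{\mathcal D}$ is $0$ on $\mathcal D$ and $+\infty$ elsewhere; $\mathrm{dist}_S(y)=\inf_{u\in S}\|y-u\|_2$; $\mathrm{proj}_{\mathcal D}$ is the Euclidean projection. For $\beta>0$ the Moreau envelope is $g^\beta(y)=\min_u\{g(u)+\frac1{2\beta}\|u-y\|_2^2\}=\frac1{2\beta}\mathrm{dist}_{\mathcal D}^2(y)$, with $\nabla g^\beta(y)=\beta^{-1}(y-\mathrm{proj}_{\mathcal D}(y))$. Smoothed Frank-Wolfe gap: for $x\in\mathcal C$, $\mathrm{gap}^\beta(x):=\max_{s\in\mathcal C}\langle\nabla f(x)+T^*\nabla g^\beta(Tx),x-s\rangle$. $N_S(x)=\{v:\langle v,s-x\rangle\le0\ \forall s\in S\}$ for $x\in S$ is the normal cone. The set $\mathcal C^\dagger$ is nonempty, compact and convex, and $\delta>0$. *)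

(* Defs.v *)
From HB Require Import structures.
From mathcomp Require Import all_boot all_order all_algebra.
From mathcomp Require Import all_classical all_reals all_analysis.

Set Implicit Arguments.
Unset Strict Implicit.
Unset Printing Implicit Defensive.

Import Order.TTheory GRing.Theory Num.Theory.
Import numFieldNormedType.Exports.

Local Open Scope classical_set_scope.
Local Open Scope ring_scope.

(* x0 is the junk value returned when no maximum (resp. minimum) exists. *)
Definition setmax {d : Order.disp_t} {T : porderType d} (x0 : T) (A : set T) : T :=
  xget x0 (A `&` ubound A).

Definition setmin {d : Order.disp_t} {T : porderType d} (x0 : T) (A : set T) : T :=
  xget x0 (A `&` lbound A).

Definition argmin {T : Type} {R : realType} (A : set T) (h : T -> R) : set T :=
  [set x | A x /\ forall y, A y -> h x <= h y].

(* The library norm `|x| on 'rV[R]_n is the sup norm, hence norm2; both norms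
   induce the same topology, so the library's compact, closed, open,
   differentiable and --> are used on 'rV[R]_n. *)
Definition dotp {R : realType} {n : nat} (x y : 'rV[R]_n) : R :=
  \sum_(i < n) x 0 i * y 0 i.

Definition norm2 {R : realType} {n : nat} (x : 'rV[R]_n) : R :=
  Num.sqrt (dotp x x).

Definition dist2 {R : realType} {n : nat} (S : set 'rV[R]_n) (y : 'rV[R]_n) : R :=
  inf [set norm2 (y - u) | u in S].

Definition proj2 {R : realType} {n : nat} (S : set 'rV[R]_n) (y : 'rV[R]_n) :
  'rV[R]_n := xget 0 (argmin S (fun u => norm2 (y - u))).

Definition grad {R : realType} {n : nat} (f : 'rV[R]_n -> R) (x : 'rV[R]_n) :
  'rV[R]_n := \row_(i < n) 'D_(delta_mx 0 i) f x.

Definition C1_near {R : realType} {n : nat} (f : 'rV[R]_n -> R)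
    (C : set 'rV[R]_n) : Prop :=
  exists O : set 'rV[R]_n, [/\ open O, C `<=` O &
    forall x, O x -> differentiable f x /\ {for x, continuous (grad f)}].

Definition lipschitz2_on {R : realType} {n p : nat} (C : set 'rV[R]_n)
    (F : 'rV[R]_n -> 'rV[R]_p) : Prop :=
  exists L : R, forall x y, C x -> C y ->
    norm2 (F x - F y) <= L * norm2 (x - y).

Definition adjoint {R : realType} {n m : nat}
    (T : {linear 'rV[R]_n -> 'rV[R]_m}) (y : 'rV[R]_m) : 'rV[R]_n :=
  y *m (lin1_mx T)^T.

(* Convex-analysis indicator with values 0 and +oo, not the 0/1-valued \1_D. *)
Definition iota_set {R : realType} {n : nat} (D : set 'rV[R]_n) (y : 'rV[R]_n) :
  \bar R := if y \in D then 0%E else +oo%E.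

Definition moreau {R : realType} {n : nat} (g : 'rV[R]_n -> \bar R) (beta : R)
    (y : 'rV[R]_n) : R :=
  fine (setmin 0%E
    [set (g u + ((2 * beta)^-1 * norm2 (u - y) ^+ 2)%:E)%E | u in setT]).

Definition gap {R : realType} {n m : nat} (f : 'rV[R]_n -> R)
    (T : {linear 'rV[R]_n -> 'rV[R]_m}) (g : 'rV[R]_m -> \bar R)
    (C : set 'rV[R]_n) (beta : R) (x : 'rV[R]_n) : R :=
  setmax 0 [set dotp (grad f x + adjoint T (grad (moreau g beta) (T x))) (x - s)
           | s in C].

(* Meant for x in S. *)
Definition normal_cone {R : realType} {n : nat} (S : set 'rV[R]_n)
    (x : 'rV[R]_n) : set 'rV[R]_n :=
  [set v | forall s, S s -> dotp v (s - x) <= 0].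

Lemma setmaxE d (T : porderType d) (x0 : T) (A : set T) m :
  A m -> ubound A m -> setmax x0 A = m.
Proof.
move=> Am ubm; apply: xget_unique => // y [Ay uby].
by apply/eqP; rewrite eq_le ubm//= uby.
Qed.

Lemma setminE d (T : porderType d) (x0 : T) (A : set T) m :
  A m -> lbound A m -> setmin x0 A = m.
Proof.
move=> Am lbm; apply: xget_unique => // y [Ay lby].
by apply/eqP; rewrite eq_le lbm//= lby.
Qed.

Lemma dotpE (R : realType) n (x y : 'rV[R]_n) : dotp x y = (x *m y^T) 0 0.
Proof. by rewrite mxE; apply: eq_bigr => i _; rewrite mxE. Qed.

Lemma adjointP (R : realType) n m (T : {linear 'rV[R]_n -> 'rV[R]_m}) x y :
  dotp (T x) y = dotp x (adjoint T y).
Proof.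
by rewrite !dotpE /adjoint trmx_mul trmxK -(mul_rV_lin1 T x) mulmxA.
Qed.

Lemma gradP (R : realType) n (f : 'rV[R]_n -> R) x v :
  differentiable f x -> 'd f x v = dotp (grad f x) v.
Proof.
move=> df; rewrite {1}(row_sum_delta v) linear_sum; apply: eq_bigr => i _.
by rewrite linearZ/= mxE deriveE// mulrC.
Qed.

Lemma dotp_continuous (R : realType) n (F G : 'rV[R]_n -> 'rV[R]_n) :
  continuous F -> continuous G -> continuous (fun x => dotp (F x) (G x)).
Proof.
move=> cF cG.
have coordc (H : 'rV[R]_n -> 'rV[R]_n) i :
    continuous H -> continuous (fun x => H x 0 i).
  move=> cH x.
  exact: (continuous_comp (cH x) (@coord_continuous _ _ _ _ _ _)).
suff cs r : continuous (fun x => \sum_(i <- r) F x 0 i * G x 0 i) by exact: cs.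
elim: r => [|i r IH].
  rewrite (_ : (fun x => _) = cst 0); first exact: cst_continuous.
  by apply/funext => x; rewrite big_nil.
rewrite (_ : (fun x => _) = (fun x => F x 0 i * G x 0 i +
    \sum_(j <- r) F x 0 j * G x 0 j)); last first.
  by apply/funext => x; rewrite big_cons.
move=> x; apply: (@continuousD _ _ _ (fun x => F x 0 i * G x 0 i)).
  by apply: continuousM; exact: coordc.
exact: IH.
Qed.

Lemma subl_continuous (R : realType) n (y : 'rV[R]_n) :
  continuous (fun u : 'rV[R]_n => y - u).
Proof.
move=> u; apply: (@continuousB R 'rV[R]_n 'rV[R]_n (cst y) id u).
  exact: cst_continuous.
exact: cvg_id.
Qed.

Lemma norm2_continuous (R : realType) n (y : 'rV[R]_n) :
  continuous (fun u : 'rV[R]_n => norm2 (y - u)).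
Proof.
have c := @subl_continuous R n y; move=> u.
apply: (@continuous_comp _ _ _ (fun u : 'rV[R]_n => dotp (y - u) (y - u))
  Num.sqrt u); last exact: sqrt_continuous.
exact: (dotp_continuous c c).
Qed.

(* Maxima of linear forms over compact sets, such as gap, are attained. *)
Lemma setmax_dotpP (R : realType) n (C : set 'rV[R]_n) (v x : 'rV[R]_n) :
  C !=set0 -> compact C -> exists2 s, C s &
    setmax 0 [set dotp v (x - s) | s in C] = dotp v (x - s) /\
    (forall t, C t -> dotp v (x - t) <= dotp v (x - s)).
Proof.
move=> C0 cC.
have c : continuous (fun s : 'rV[R]_n => dotp v (x - s)).
  by apply: dotp_continuous; [exact: cst_continuous|exact: subl_continuous].
have [s Cs ms] := EVT_max_rV C0 cC (continuous_subspaceT c).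
move: Cs; rewrite inE => Cs; exists s => //.
have {}ms t : C t -> dotp v (x - t) <= dotp v (x - s).
  by move=> Ct; apply: ms; rewrite inE.
split=> //; apply: setmaxE; first by exists s.
by move=> _ [t Ct <-]; exact: ms.
Qed.

Lemma norm2_ge0 (R : realType) n (x : 'rV[R]_n) : 0 <= norm2 x.
Proof. exact: sqrtr_ge0. Qed.

Lemma norm2N (R : realType) n (x : 'rV[R]_n) : norm2 (- x) = norm2 x.
Proof.
by congr Num.sqrt; apply: eq_bigr => i _; rewrite !mxE mulrNN.
Qed.

Lemma coord_le_norm2 (R : realType) n (x : 'rV[R]_n) i : `|x 0 i| <= norm2 x.
Proof.
rewrite -sqrtr_sqr ler_wsqrtr// expr2 /dotp (bigD1 i)//= lerDl.
by apply: sumr_ge0 => j _; rewrite -expr2 sqr_ge0.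
Qed.

Lemma argmin_norm2_neq0 (R : realType) n (D : set 'rV[R]_n) (y : 'rV[R]_n) :
  D !=set0 -> closed D -> argmin D (fun u => norm2 (y - u)) !=set0.
Proof.
move=> [u0 Du0] clD.
pose r := norm2 (y - u0).
pose K := D `&` [set u | norm2 (y - u) <= r].
have clK : closed K.
  apply: closedI => //.
  apply: (@preimage_closed _ _ (fun u : 'rV[R]_n => norm2 (y - u))
    [set t | t <= r]); last exact: closed_le.
  by move=> u _; exact: norm2_continuous.
have bK : bounded_set K.
  exists (r + `|y|); split; first exact: num_real.
  move=> M rM u [_ /= ur]; apply: le_trans (ltW rM).
  have -> : u = y - (y - u) by rewrite opprB addrC subrK.
  apply: (le_trans (ler_normB _ _)); rewrite addrC lerD2r.
  rewrite [leLHS]mx_normrE; apply: bigmax_le => [|[i j] _]; first exact: norm2_ge0.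
  by rewrite ord1; exact: le_trans (coord_le_norm2 _ _) ur.
have K0 : K !=set0 by exists u0; split => //=.
have [p] := compact_EVT_min K0 (bounded_closed_compact bK clK)
  (continuous_subspaceT (@norm2_continuous R n y)).
rewrite inE => -[Dp /= pr] mp; exists p; split => // u Du.
have [ur|/ltW ru] := leP (norm2 (y - u)) r; last exact: le_trans pr ru.
by apply: mp; rewrite inE.
Qed.

Lemma proj2P (R : realType) n (D : set 'rV[R]_n) (y : 'rV[R]_n) :
  D !=set0 -> closed D -> D (proj2 D y) /\ dist2 D y = norm2 (y - proj2 D y).
Proof.
move=> D0 clD; have [p pmin] := argmin_norm2_neq0 y D0 clD.
have [Dp mp] : argmin D (fun u => norm2 (y - u)) (proj2 D y).
  exact: (@xgetPex _ 0 _ (ex_intro _ p pmin)).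
split=> //; apply/eqP; rewrite eq_le; apply/andP; split.
  apply: ge_inf; last by exists (proj2 D y).
  by exists 0 => _ [u _ <-]; exact: norm2_ge0.
apply: lb_le_inf; first by case: D0 => u Du; exists (norm2 (y - u)), u.
by move=> _ [u Du <-]; exact: mp.
Qed.

Lemma moreau_iotaE (R : realType) n (D : set 'rV[R]_n) beta (y : 'rV[R]_n) :
  D !=set0 -> closed D -> 0 < beta ->
  moreau (iota_set D) beta y = (2 * beta)^-1 * dist2 D y ^+ 2.
Proof.
move=> D0 clD b0; have [Dp dE] := proj2P y D0 clD.
rewrite /moreau (@setminE _ _ _ _ ((2 * beta)^-1 * dist2 D y ^+ 2)%:E)//.
  exists (proj2 D y) => //; rewrite /iota_set mem_set// add0e dE.
  by rewrite -[in RHS]norm2N opprB.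
move=> _ [u _ <-]; rewrite /iota_set; case: ifPn => [|_]; last first.
  by rewrite addye// leey.
rewrite inE => Du; rewrite add0e lee_fin ler_wpM2l//.
  by rewrite invr_ge0 mulr_ge0// ltW.
have du : dist2 D y <= norm2 (u - y).
  rewrite -norm2N opprB; apply: ge_inf; last by exists u.
  by exists 0 => _ [v _ <-]; exact: norm2_ge0.
by rewrite lerXn2r// nnegrE ?norm2_ge0// dE norm2_ge0.
Qed.

(* Main.v *)
Require Import Defs.
From mathcomp Require Import all_boot all_order all_algebra.
From mathcomp Require Import all_classical all_reals all_analysis.
From mathcomp Require Import ring lra.
Import Order.TTheory GRing.Theory Num.Theory.
Import numFieldNormedType.Exports.
Local Open Scope classical_set_scope.
Local Open Scope ring_scope.

(* With p the projection of y on D, the obtuse-angle inequality gives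
     dist(y)^2 + 2 <y - p, z - y> <= dist(z)^2
       <= dist(y)^2 + 2 <y - p, z - y> + |z - y|^2,
   hence both the formula for the gradient of the Moreau envelope and the
   convexity of dist^2.  Testing the gap at s in C therefore yields
     <grad f(x), x - s> + (dist(T x)^2 - dist(T s)^2) / (2 beta) <= gap(x).
   Multiplying by 2 alpha_j and letting j tend to infinity shows that the limit
   point minimizes dist o T; for s in Cdag the second term is nonnegative, so
   <grad f(u_j), u_j - s> <= gap(u_j), which gives the remaining claims. *)

(** * Euclidean inner product: bilinearity, limits, and one-dimensional tools *)

Lemma dotpC {R : realType} {n} (x y : 'rV[R]_n) : dotp x y = dotp y x.
Proof. by apply: eq_bigr => i _; rewrite mulrC. Qed.

Lemma dotpDl {R : realType} {n} (x y z : 'rV[R]_n) :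
  dotp (x + y) z = dotp x z + dotp y z.
Proof. by rewrite -big_split; apply: eq_bigr => i _; rewrite mxE mulrDl. Qed.

Lemma dotpZl {R : realType} {n} a (x y : 'rV[R]_n) :
  dotp (a *: x) y = a * dotp x y.
Proof. by rewrite mulr_sumr; apply: eq_bigr => i _; rewrite mxE mulrA. Qed.

Lemma dotpNl {R : realType} {n} (x y : 'rV[R]_n) : dotp (- x) y = - dotp x y.
Proof. by rewrite -scaleN1r dotpZl mulN1r. Qed.

Lemma dotpDr {R : realType} {n} (x y z : 'rV[R]_n) :
  dotp x (y + z) = dotp x y + dotp x z.
Proof. by rewrite dotpC dotpDl !(dotpC _ x). Qed.

Lemma dotpZr {R : realType} {n} a (x y : 'rV[R]_n) :
  dotp x (a *: y) = a * dotp x y.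
Proof. by rewrite dotpC dotpZl dotpC. Qed.

Lemma dotpNr {R : realType} {n} (x y : 'rV[R]_n) : dotp x (- y) = - dotp x y.
Proof. by rewrite dotpC dotpNl dotpC. Qed.

Lemma dotp0r {R : realType} {n} (x : 'rV[R]_n) : dotp x 0 = 0.
Proof. by rewrite -(scale0r x) dotpZr mul0r. Qed.

Definition dotp_lin := (@dotpDl, @dotpDr, @dotpNl, @dotpNr, @dotpZl, @dotpZr).

Lemma dotp_ge0 {R : realType} {n} (x : 'rV[R]_n) : 0 <= dotp x x.
Proof. by apply: sumr_ge0 => i _; rewrite -expr2 sqr_ge0. Qed.

Lemma norm2_sqr {R : realType} {n} (x : 'rV[R]_n) : norm2 x ^+ 2 = dotp x x.
Proof. by rewrite sqr_sqrtr// dotp_ge0. Qed.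

Lemma cvg_dotp {R : realType} {n} {I} {F : set_system I} {FF : Filter F}
    {g h : I -> 'rV[R]_n} {a b : 'rV[R]_n} :
  g i @[i --> F] --> a -> h i @[i --> F] --> b ->
  dotp (g i) (h i) @[i --> F] --> dotp a b.
Proof.
move=> ga hb; apply: cvg_big => [|k _]; first exact: add_continuous.
apply: cvgM.
- exact: (cvg_comp _ _ ga (@coord_continuous _ _ _ 0 k a)).
- exact: (cvg_comp _ _ hb (@coord_continuous _ _ _ 0 k b)).
Qed.

Lemma linear_rV_continuous {R : realType} {n m}
  (T : {linear 'rV[R]_n -> 'rV[R]_m}) : continuous T.
Proof.
have -> : T = (fun x => \sum_j x 0 j *: T (delta_mx 0 j)) :> (_ -> _).
  apply/funext => x; rewrite {1}(row_sum_delta x) linear_sum.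
  by apply: eq_bigr => j _; rewrite linearZ.
move=> x; apply: cvg_big; [exact: add_continuous|exact: nbhs_filter|move=> j _].
apply: cvgZr_tmp; [exact: nbhs_filter|exact: coord_continuous].
Qed.

(* If c < 0, the witness t = - c / (|d| - c) has |d| * t < - c. *)
Lemma slope_ge0 {R : realType} (c d : R) :
  (forall t, 0 < t -> t <= 1 -> 0 <= c * t + d * t ^+ 2) -> 0 <= c.
Proof.
move=> h; rewrite leNgt; apply/negP => c0.
have e0 : 0 < `|d| - c by have := normr_ge0 d; lra.
have t0 : 0 < - c / (`|d| - c) by rewrite divr_gt0// oppr_gt0.
have t1 : - c / (`|d| - c) <= 1 by rewrite ler_pdivrMr// mul1r lerDr.
have te : - c / (`|d| - c) * (`|d| - c) = - c by rewrite divfK// gt_eqF.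
move: (- c / _) t0 t1 te => t t0 t1 te.
have : `|d| * t < - c by nra.
have : d * t <= `|d| * t by rewrite ler_wpM2r ?ler_norm// ltW.
by have := h _ t0 t1; rewrite expr2 mulrA -mulrDl pmulr_lge0//; lra.
Qed.

(** Restates convexity with a plain real weight. [conv] puts the weight [t] on its first point,
    hence the order [y x] in the use of [cS]. *)
Lemma convex_setP {R : realType} {n} {S : set 'rV[R]_n} {x y : 'rV[R]_n} {t : R} :
  convex_set S -> S x -> S y -> 0 <= t -> t <= 1 -> S (x + t *: (y - x)).
Proof.
move=> cS Sx Sy t0 t1.
have ti : Itv.spec (@Itv.num_sem R) (Itv.Real `[0%Z, 1%Z]) t.
  by rewrite /Itv.spec /Itv.num_sem /= num_real/= in_itv/= t0 t1.
have := cS y x (Itv.Def ti) (mem_set Sy) (mem_set Sx); rewrite inE.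
congr (S _); rewrite /conv /= /unstable.onem/=.
by rewrite scalerBr scalerBl scale1r addrCA addrA.
Qed.

(** * Squared distance to a closed convex set, and the gradient of its envelope *)

Section dist2.
Context {R : realType} {n : nat}.
Context {D : set 'rV[R]_n}.
Hypotheses (D0 : D !=set0) (clD : closed D) (cvD : convex_set D).
Implicit Types y z : 'rV[R]_n.

Lemma dist2_ge0 y : 0 <= dist2 D y.
Proof. by have [_ ->] := proj2P y D0 clD; exact: norm2_ge0. Qed.

Lemma dist2_sqr_le y u : D u -> dist2 D y ^+ 2 <= dotp (y - u) (y - u).
Proof.
move=> Du; rewrite -norm2_sqr ler_sqr ?nnegrE ?norm2_ge0 ?dist2_ge0//.
apply: ge_inf; last by exists u.
by exists 0 => _ [v _ <-]; exact: norm2_ge0.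
Qed.

Lemma dist2_sqr_proj y :
  dist2 D y ^+ 2 = dotp (y - proj2 D y) (y - proj2 D y).
Proof. by have [_ ->] := proj2P y D0 clD; exact: norm2_sqr. Qed.

(** Moving from the projection towards [u] stays in [D], so the squared distance to [y] cannot drop;
    its linear coefficient along the segment is therefore nonnegative. *)
Lemma proj2_obtuse y u : D u -> dotp (y - proj2 D y) (u - proj2 D y) <= 0.
Proof.
move=> Du; have [Dp _] := proj2P y D0 clD.
(* The factor 2 is the one of the linear term in the expanded square. *)
rewrite -oppr_ge0 -(pmulr_rge0 _ (ltr0Sn R 1)).
apply: (@slope_ge0 _ _ (dotp (u - proj2 D y) (u - proj2 D y))) => t t0 t1.
have := dist2_sqr_le y _ (convex_setP cvD Dp Du (ltW t0) t1).
rewrite dist2_sqr_proj opprD addrA.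
move: (y - _) (u - _) => a b; rewrite !dotp_lin (dotpC b a) => h.
by move: h; rewrite expr2; lra.
Qed.

(** With [a], [b] the residuals of [z], [y] and [c] the difference of their projections, right side
    minus left side is |a - b|^2 - 2 <b, c>, and <b, c> <= 0 by the obtuse angle. *)
Lemma dist2_sqr_subgradient y z :
  dist2 D y ^+ 2 + 2 * dotp (y - proj2 D y) (z - y) <= dist2 D z ^+ 2.
Proof.
have [Dq _] := proj2P z D0 clD.
have := proj2_obtuse y _ Dq; rewrite !dist2_sqr_proj.
have := dotp_ge0 ((z - proj2 D z) - (y - proj2 D y)).
have -> : z - y = (z - proj2 D z) - (y - proj2 D y) + (proj2 D z - proj2 D y).
  by apply/rowP => i; rewrite !mxE; ring.
move: (z - _) (y - _) (proj2 D z - _) => a b c.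
by rewrite !dotp_lin (dotpC b a); lra.
Qed.

(** The projection of [y] is a competitor for the distance from [z]. *)
Lemma dist2_sqr_upper y z :
  dist2 D z ^+ 2 <=
  dist2 D y ^+ 2 + 2 * dotp (y - proj2 D y) (z - y) + dotp (z - y) (z - y).
Proof.
have [Dp _] := proj2P y D0 clD.
apply: (le_trans (dist2_sqr_le z _ Dp)); rewrite dist2_sqr_proj.
have -> : z - proj2 D y = (z - y) + (y - proj2 D y) by rewrite addrA subrK.
move: (z - y) (y - _) => a b.
by rewrite !dotp_lin (dotpC b a); lra.
Qed.

(** The two quadratic bounds squeeze the squared distance; the square root is then continuous. *)
Lemma cvg_dist2 {I} {F : set_system I} {FF : Filter F} {z : I -> 'rV[R]_n} {y} :
  z i @[i --> F] --> y -> dist2 D (z i) @[i --> F] --> dist2 D y.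
Proof.
move=> zy.
have sqrtE x : dist2 D x = Num.sqrt (dist2 D x ^+ 2).
  by rewrite sqrtr_sqr ger0_norm// dist2_ge0.
rewrite sqrtE; under eq_cvg do rewrite sqrtE.
apply: (cvg_comp (fun i => dist2 D (z i) ^+ 2) Num.sqrt _ (@sqrt_continuous R _)).
have {}zy : (z i - y) @[i --> F] --> (0 : 'rV[R]_n).
  by rewrite -[X in _ --> X](subrr y); apply: cvgB => //; exact: cvg_cst.
have l : dist2 D y ^+ 2 + 2 * dotp (y - proj2 D y) (z i - y) @[i --> F] -->
    dist2 D y ^+ 2.
  rewrite -[X in _ --> X]addr0; apply: cvgD; first exact: cvg_cst.
  rewrite -[X in _ --> X](mulr0 2) -(dotp0r (y - proj2 D y)).
  by apply: cvgMl_tmp; exact: (cvg_dotp (cvg_cst _) zy).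
apply: (squeeze_cvgr _ l).
  near=> i; apply/andP; split.
    exact: dist2_sqr_subgradient.
  exact: dist2_sqr_upper.
rewrite -[X in _ --> X]addr0 -(dotp0r (0 : 'rV[R]_n)).
by apply: cvgD => //; exact: (cvg_dotp zy zy).
Unshelve. all: by end_near. Qed.

(** Each partial derivative is computed from its difference quotient: the two quadratic bounds leave
    an error of at most |h| |e|^2 / (2 beta). *)
Lemma grad_moreau_iota (beta : R) y : 0 < beta ->
  grad (moreau (iota_set D) beta) y = beta^-1 *: (y - proj2 D y).
Proof.
move=> b0; apply/rowP => i; rewrite !mxE.
set e : 'rV[R]_n := delta_mx 0 i; set p := proj2 D y.
have -> : beta^-1 * (y 0 i + - p 0 i) = beta^-1 * dotp (y - p) e.
  rewrite /dotp (bigD1 i)//= big1 ?addr0 => [|j ji].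
    by rewrite !mxE !eqxx mulr1.
  by rewrite !mxE eqxx (negPf ji) mulr0.
apply/cvg_lim => //; apply/cvgrPdist_le => eps eps0; near=> h.
have h0 : h != 0 by near: h; exact: nbhs_dnbhs_neq.
rewrite /= !moreau_iotaE// -/p.
have hz : h *: e + y - y = h *: e by rewrite addrK.
have := dist2_sqr_subgradient y (h *: e + y).
have := dist2_sqr_upper y (h *: e + y).
rewrite hz -/p !dotpZr dotpZl.
set a := dist2 D _ ^+ 2; set b := dist2 D y ^+ 2; set c := dotp _ e.
set q := dotp e e => up lo.
(* [w] is the first-order remainder; the two bounds say 0 <= w <= h^2 q. *)
set w := a - b - 2 * (h * c).
have -> : beta^-1 * c - h^-1 *: ((2 * beta)^-1 * a - (2 * beta)^-1 * b) =
    - (h^-1 * ((2 * beta)^-1 * w)).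
  rewrite /GRing.scale/= /w; by field; rewrite h0 gt_eqF.
have w0 : 0 <= w by rewrite /w; lra.
have wh : w <= `|h| * (`|h| * q).
  by rewrite mulrA -normrM ger0_norm -?expr2 ?sqr_ge0// expr2 /w; lra.
rewrite normrN normrM normfV mulrC ler_pdivrMr ?normr_gt0//.
rewrite ger0_norm; last by rewrite mulr_ge0// invr_ge0 ltW// mulr_gt0.
rewrite ler_pdivrMl ?mulr_gt0//; apply: (le_trans wh).
rewrite [leRHS]mulrA [leRHS]mulrC ler_wpM2l//.
(* [q + 1] is visibly positive, so it can serve as a divisor in the threshold on |h|. *)
apply: (@le_trans _ _ (`|h| * (q + 1))); first by rewrite ler_wpM2l// lerDl.
have q1 : 0 < q + 1 by rewrite ltr_wpDl// dotp_ge0.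
rewrite -ler_pdivlMr//; near: h; apply: dnbhs0_le.
by rewrite divr_gt0 ?mulr_gt0// ltr_wpDl// dotp_ge0.
Unshelve. all: by end_near. Qed.
End dist2.

(** * Gap estimate and first-order conditions *)

(** By compactness the gap is a true maximum, so it dominates its value at [s]. The adjoint turns
    the penalty term into <T x - p, T x - T s> / beta, with p the projection of T x, and
    [dist2_sqr_subgradient] bounds it below. *)
Lemma gap_ge {R : realType} {n m} {C : set 'rV[R]_n} (f : 'rV[R]_n -> R)
    (T : {linear 'rV[R]_n -> 'rV[R]_m}) {D : set 'rV[R]_m} {beta : R} x {s} :
  compact C -> D !=set0 -> closed D -> convex_set D -> 0 < beta -> C s ->
  dotp (grad f x) (x - s) +
    (2 * beta)^-1 * (dist2 D (T x) ^+ 2 - dist2 D (T s) ^+ 2)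
  <= gap f T (iota_set D) C beta x.
Proof.
move=> cC D0 clD cvD b0 Cs.
have [t _ [Et /(_ s Cs) st]] := setmax_dotpP
  (grad f x + adjoint T (grad (moreau (iota_set D) beta) (T x))) x
  (ex_intro _ s Cs) cC.
rewrite /gap Et; apply: le_trans st.
rewrite dotpDl lerD2l (dotpC (adjoint _ _)) -adjointP linearB.
rewrite (grad_moreau_iota D0 clD cvD)// dotpZr invfM mulrAC.
rewrite [leLHS]mulrC ler_pM2l ?invr_gt0// ler_pdivrMl//.
have := dist2_sqr_subgradient D0 clD cvD (T x) (T s).
by rewrite -(opprB (T x) (T s)) dotpNr (dotpC (T x - T s)); lra.
Qed.

(** Along the segment from [x] to [s], minimality and [dist2_sqr_upper] make a quadratic in [t]
    nonnegative on ]0, 1]; the claim is the sign of its slope. *)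
Lemma argmin_dist2_optimality {R : realType} {n m} (C : set 'rV[R]_n)
    (T : {linear 'rV[R]_n -> 'rV[R]_m}) (D : set 'rV[R]_m) x s :
  convex_set C -> D !=set0 -> closed D -> convex_set D ->
  argmin C (fun z => dist2 D (T z)) x -> C s ->
  0 <= dotp (T x - proj2 D (T x)) (T (s - x)).
Proof.
move=> cvC D0 clD cvD [Cx xmin] Cs; rewrite -(pmulr_rge0 _ (ltr0Sn R 1)).
apply: (@slope_ge0 _ _ (dotp (T (s - x)) (T (s - x)))) => t t0 t1.
have Cz := convex_setP cvC Cx Cs (ltW t0) t1.
have := dist2_sqr_upper D0 clD (T x) (T (x + t *: (s - x))).
have : dist2 D (T x) ^+ 2 <= dist2 D (T (x + t *: (s - x))) ^+ 2.
  by rewrite ler_sqr ?nnegrE ?dist2_ge0//; exact: xmin.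
rewrite -(linearB T) (addrC x) addrK linearZ/=.
move: (T x - _) (T (s - x)) => a b; rewrite !dotp_lin expr2; lra.
Qed.

(** For 0 < h <= 1 convexity bounds the difference quotient towards [s] by [f s - f x]; the bound
    passes to the limit from the right. *)
Lemma convex_grad_le {R : realType} {n} {S : set 'rV[R]_n} {f : 'rV[R]_n -> R}
    {x s} : convex_function S f -> differentiable f x -> S x -> S s ->
  dotp (grad f x) (s - x) <= f s - f x.
Proof.
move=> cf df Sx Ss.
have /cvg_ex[/= l lP] := @diff_derivable _ _ _ f x (s - x) df.
have <- : l = dotp (grad f x) (s - x).
  by rewrite -gradP// -deriveE//; apply/esym/cvg_lim.
apply: (cvgr_to_le (cvg_dnbhs_at_right lP)).
near=> h.
have h0 : 0 < h by near: h; exact: nbhs_right_gt.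
have h1 : h <= 1 by near: h; exact: nbhs_right_le.
have hi : Itv.spec (@Itv.num_sem R) (Itv.Real `[0%Z, 1%Z]) h.
  by rewrite /Itv.spec /Itv.num_sem /= num_real/= in_itv/= (ltW h0) h1.
have := cf (Itv.Def hi) s x (mem_set Ss) (mem_set Sx).
rewrite convRE /conv/= /unstable.onem/=.
have -> : h *: s + (1 - h) *: x = h *: (s - x) + x.
  by apply/rowP => i; rewrite !mxE; ring.
move=> c; rewrite /GRing.scale/= ler_pdivrMl//; lra.
Unshelve. all: by end_near. Qed.

Theorem theorem6p7 (R : realType) (n m : nat) (C : set 'rV[R]_n)
    (f : 'rV[R]_n -> R) (T : {linear 'rV[R]_n -> 'rV[R]_m}) (D : set 'rV[R]_m)
    (u : nat -> 'rV[R]_n) (alpha : nat -> R) (ubar : 'rV[R]_n) :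
  C !=set0 -> compact C -> convex_set C ->
  C1_near f C -> lipschitz2_on C (grad f) ->
  D !=set0 -> closed D -> convex_set D ->
  D `&` (T @` C) = set0 ->
  let g := iota_set D in
  let delta := setmin 0 [set dist2 D (T x) | x in C] in
  let Cdag := argmin C (fun x => dist2 D (T x)) in
  (forall j, C (u j)) ->
  (forall j, 0 < alpha j) ->
  alpha j @[j --> \oo] --> 0 ->
  u j @[j --> \oo] --> ubar ->
  gap f T g C (alpha j) (u j) @[j --> \oo] --> 0 ->
  [/\ dist2 D (T (u j)) @[j --> \oo] --> delta,
      dist2 Cdag (u j) @[j --> \oo] --> 0,
      setmax 0 [set dotp (grad f (u j)) (u j - s) | s in Cdag]
        @[j --> \oo] --> 0 &
      forall v : 'rV[R]_n, cluster (u j @[j --> \oo]) v ->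
        [/\ Cdag v,
            [set adjoint T (T v - proj2 D (T v)) + w | w in normal_cone C v] 0,
            [set grad f v + w | w in normal_cone Cdag v] 0,
            setmax 0 [set dotp (grad f v) (v - s) | s in Cdag] = 0 &
            convex_function Cdag f -> argmin Cdag f v]].
Proof.
move=> C0 cC cvC [U [_ CU fU]] _ D0 clD cvD _ g delta Cdag Cu a0 acvg ucvg
  gcvg.
have Cubar : C ubar.
  apply: (closed_cvg _ _ _ _ ucvg);
    first exact: compact_closed (@norm_hausdorff _ _) cC.
  by near=> j; exact: Cu.
have [df cf] := fU _ (CU _ Cubar).
have gradcvg : grad f (u j) @[j --> \oo] --> grad f ubar.
  exact: (cvg_comp _ _ ucvg cf).
have Tcvg : T (u j) @[j --> \oo] --> T ubar.
  exact: (cvg_comp _ _ ucvg (linear_rV_continuous T ubar)).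
have dcvg : dist2 D (T (u j)) @[j --> \oo] --> dist2 D (T ubar).
  exact: cvg_dist2.
have slopecvg s : dotp (grad f (u j)) (u j - s) @[j --> \oo] -->
    dotp (grad f ubar) (ubar - s).
  by apply: (cvg_dotp gradcvg); apply: cvgB => //; exact: cvg_cst.
have ubarC : Cdag ubar.
  split => // s Cs; rewrite -ler_sqr ?nnegrE ?dist2_ge0//.
  (* This is the gap estimate solved for the squared distance at [u j]. The gap and the slope
     converge, so the factor [alpha j] removes their contribution in the limit. *)
  have l : dist2 D (T s) ^+ 2 + 2 * alpha j *
      (gap f T g C (alpha j) (u j) - dotp (grad f (u j)) (u j - s))
      @[j --> \oo] -->
      dist2 D (T s) ^+ 2 + 2 * 0 * (0 - dotp (grad f ubar) (ubar - s)).
    apply: cvgD; first exact: cvg_cst.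
    by apply: cvgM; [exact: cvgMl_tmp|exact: cvgB].
  rewrite mulr0 mul0r addr0 in l.
  have dcvg2 : dist2 D (T (u j)) ^+ 2 @[j --> \oo] --> dist2 D (T ubar) ^+ 2.
    by rewrite expr2; under eq_cvg do rewrite expr2; apply: cvgM.
  apply: (ler_cvg_to dcvg2 l); near=> j.
  have := gap_ge f T (u j) cC D0 clD cvD (a0 j) Cs.
  by rewrite -lerBlDl -ler_pdivrMl ?mulr_gt0// lerBrDl.
have deltaE : delta = dist2 D (T ubar).
  apply: setminE; first by exists ubar.
  by move=> _ [s Cs <-]; apply: ubarC.2.
have gap_ub j s : Cdag s ->
    dotp (grad f (u j)) (u j - s) <= gap f T g C (alpha j) (u j).
  move=> [Cs smin].
  have := gap_ge f T (u j) cC D0 clD cvD (a0 j) Cs.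
  apply: le_trans; rewrite lerDl mulr_ge0 ?invr_ge0 ?mulr_ge0 ?(ltW (a0 j))//.
  by rewrite subr_ge0 ler_sqr ?nnegrE ?dist2_ge0// smin.
(* Compactness makes [setmax] over [Cdag] an attained maximum rather than the default 0. [Cdag] is a
   sublevel set in [C] of a continuous function. *)
have cCdag : compact Cdag.
  have -> : Cdag = C `&` [set x | dist2 D (T x) <= dist2 D (T ubar)].
    apply/seteqP; split => x [Cx h]; split => //=; first exact: h.
    by move=> y Cy; apply: (le_trans h); exact: ubarC.2.
  apply: compact_closedI => //.
  apply: (@preimage_closed _ _ (fun x => dist2 D (T x)) [set t | t <= _]);
    last exact: closed_le.
  move=> x _; exact: (cvg_dist2 D0 clD cvD (linear_rV_continuous T x)).
have stat s : Cdag s -> dotp (grad f ubar) (ubar - s) <= 0.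
  move=> Cs; apply: (ler_cvg_to (slopecvg s) gcvg).
  by near=> j; exact: gap_ub.
split.
- by rewrite deltaE.
(* Since [ubar] lies in [Cdag], the distance to [Cdag] is at most the distance to [ubar]. *)
- have l : norm2 (ubar - u j) @[j --> \oo] --> 0.
    have -> : 0 = norm2 (ubar - ubar) by rewrite subrr /norm2 dotp0r sqrtr0.
    exact: (cvg_comp _ _ ucvg (@norm2_continuous _ _ ubar ubar)).
  apply: (squeeze_cvgr _ (cvg_cst 0) l); near=> j; apply/andP; split.
    apply: lb_le_inf; first by exists (norm2 (u j - ubar)), ubar.
    by move=> _ [s _ <-]; exact: norm2_ge0.
  rewrite -norm2N opprB; apply: ge_inf; last by exists ubar.
  by exists 0 => _ [s _ <-]; exact: norm2_ge0.
(* The maximum is squeezed between its value at s = [ubar], which tends to 0, and the gap. *)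
- have l := slopecvg ubar; rewrite subrr dotp0r in l.
  apply: (squeeze_cvgr _ l gcvg); near=> j.
  have [s Cs [-> smax]] := setmax_dotpP (grad f (u j)) (u j)
    (ex_intro _ _ ubarC) cCdag.
  by rewrite smax//= gap_ub.
move=> v clv.
(* A convergent sequence in a Hausdorff space clusters only at its limit. *)
have <- : ubar = v.
  by apply: (@norm_hausdorff _ 'rV[R]_n); exact: cvg_cluster ucvg v clv.
split => //.
(* Moving [T] across the adjoint reduces normal cone membership to [argmin_dist2_optimality]. *)
- exists (- adjoint T (T ubar - proj2 D (T ubar))); last by rewrite subrr.
  move=> s Cs; rewrite dotpNl oppr_le0 dotpC -adjointP dotpC.
  exact: (argmin_dist2_optimality C).
- exists (- grad f ubar); last by rewrite subrr.
  by move=> s Cs; rewrite dotpNl -dotpNr opprB stat.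
(* Here 0 is a genuine maximum, attained at s = [ubar], and not the default value. *)
- apply: setmaxE; first by exists ubar => //; rewrite subrr dotp0r.
  by move=> _ [s Cs <-]; exact: stat.
- move=> fcv; split => // s Cs.
  have := convex_grad_le fcv df ubarC Cs.
  by have := stat s Cs; rewrite -opprB dotpNr; lra.
Unshelve. all: by end_near. Qed.
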